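(* Let $n,k,\ell$ be positive integers, and let $\Gamma=\mathrm{Cay}(\mathbb{Z}_n,\{x^k,x^{-k},x^\ell,x^{-\ell}\})$ be a connected circulant quartic graph. Then: (i) If $k$ is odd and $\ell\equiv2\pmod 4$, or $\ell$ is odd and $k\equiv2\pmod 4$, then $\Gamma$ contains a $(1,3)$-regular set if and only if $n$ is a multiple of $4$. (ii) If $k$ is odd and $\ell\equiv0\pmod 4$, or $\ell$ is odd and $k\equiv0\pmod 4$, then $\Gamma$ contains no $(1,3)$-regular set. (iii) If $k\equiv1\pmod 2$ and $\ell\equiv1\pmod 2$, then $\Gamma$ contains no $(1,3)$-regular set.
   Context: $\mathbb{Z}_n=\langle x\rangle$ denotes the cyclic group of order $n$, written multiplicatively. For a finite group $G$ with identity $e$ and an inverse-closed subset $S\subseteq G\setminus\{e\}$, the Cayley graph $\mathrm{Cay}(G,S)$ is the simple graph with vertex set $G$ in which $y$ and $z$ are adjacent if and only if $y^{-1}z\in S$. A circulant quartic graph is a graph $\mathrm{Cay}(\mathbb{Z}_n,\{x^k,x^{-k},x^\ell,x^{-\ell}\})$ where $x^k,x^{-k},x^\ell,x^{-\ell}$ are four distinct non-identity elements. For a graph $\Gamma$ and nonnegative integers $a,b$, a nonempty proper subset $C$ of $V(\Gamma)$ is an $(a,b)$-regular set of $\Gamma$ if every vertex in $C$ has exactly $a$ neighbours in $C$ and every vertex in $V(\Gamma)\setminus C$ has exactly $b$ neighbours in $C$. *)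

(* Defs.v *)
From mathcomp Require Import all_boot all_fingroup.

Set Implicit Arguments.
Unset Strict Implicit.
Unset Printing Implicit Defensive.

Local Open Scope group_scope.

(* A simple graph on a finite type is a symmetric irreflexive relation.  [Cay S]
   is one when S is inverse-closed and omits 1 ([Cay_sym], [Cay_irr]), which
   [circulant_quartic] guarantees ([quartic_setV], [quartic_set1]). *)
Definition Cay (gT : finGroupType) (S : {set gT}) : rel gT :=
  [rel y z | y^-1 * z \in S].

Lemma Cay_sym (gT : finGroupType) (S : {set gT}) :
  {in S, forall s, s^-1 \in S} -> symmetric (Cay S).
Proof.
by move=> SV y z; apply/idP/idP => /SV; rewrite /Cay /= invMg invgK.
Qed.

Lemma Cay_irr (gT : finGroupType) (S : {set gT}) :
  1 \notin S -> irreflexive (Cay S).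
Proof. by move=> /negPf S1 y; rewrite /Cay /= mulVg. Qed.

Definition quartic_set (gT : finGroupType) (x : gT) (k l : nat) : {set gT} :=
  [set x ^+ k; x ^- k; x ^+ l; x ^- l].

(* [<[x]> = [set: gT]] makes the whole group cyclic with generator x, and the
   uniqueness condition says that x^k, x^-k, x^l, x^-l are four distinct
   non-identity elements. *)
Definition circulant_quartic (gT : finGroupType) (x : gT) (k l : nat) : Prop :=
  <[x]> = [set: gT] /\ uniq [:: 1; x ^+ k; x ^- k; x ^+ l; x ^- l].

Lemma quartic_setV (gT : finGroupType) (x : gT) (k l : nat) :
  {in quartic_set x k l, forall s, s^-1 \in quartic_set x k l}.
Proof.
by move=> s; rewrite !inE => /orP[/orP[/orP[]|]|] /eqP ->;
  rewrite ?invgK eqxx ?orbT.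
Qed.

Lemma quartic_set1 (gT : finGroupType) (x : gT) (k l : nat) :
  circulant_quartic x k l -> 1 \notin quartic_set x k l.
Proof. by case=> _ /= /andP[]; rewrite !inE !orbA. Qed.

Definition connected_graph (V : finType) (e : rel V) : Prop :=
  forall y z : V, connect e y z.

Definition regular_set (V : finType) (e : rel V) (a b : nat) (C : {set V}) :
    Prop :=
  [/\ C != set0, C != [set: V],
      forall v, v \in C -> #|[set w in C | e v w]| = a
    & forall v, v \notin C -> #|[set w in C | e v w]| = b].

Definition contains_regular_set (V : finType) (e : rel V) (a b : nat) : Prop :=
  exists C : {set V}, regular_set e a b C.

(* Main.v *)
Require Import Defs.
From mathcomp Require Import all_boot all_fingroup.
From mathcomp Require Import zify cyclic.

(** Call two adjacent vertices mates when both or neither lie in C.  In a quartic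
    graph, C is a (1,3)-regular set exactly when every vertex has a single mate
    ([regular_set13P]).  Put y = x^k and z = x^l.  Around the 4-cycle v, vy,
    vyz, vz membership in C changes an even number of times; so if v and vy are
    mates, hence have no further mate, then vz and vyz are mates too, and all
    the mated edges in a coset of the subgroup
    generated by y and z are parallel, say to y.  Then multiplication by z
    always changes membership, and so does multiplication by y^2
    ([mated_alternates]).

    Such an alternation is very rigid.  Reading x^(2kl) as the l-th power of
    (x^k)^2 and as the (2k)-th power of x^l shows that l is even; reading x^(kl)
    in two ways then shows that l/2 and k have the same parity; finally,
    (x^l)^n = 1 makes n even, and ((x^k)^2)^(n/2) = 1 makes n a multiple of 4
    ([alternates_arith]).  With the roles of k and l exchanged when the mated
    edges are parallel to z, these constraints give both nonexistence results
    and the forward implication of the equivalence.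

    Conversely, when 4 divides n, exponents of x make sense modulo 4, and the
    powers x^i with i congruent to 0 or 1 modulo 4 form a (1,3)-regular set as
    soon as k is odd and l is 2 modulo 4 ([quarter_mated]). *)

Set Implicit Arguments.
Unset Strict Implicit.
Unset Printing Implicit Defensive.

Local Open Scope group_scope.

Section Mates.

Variable gT : finGroupType.
Implicit Types (C : {set gT}) (v y z : gT).

Definition mated C y z : Prop :=
  forall v, count (fun s => (v * s \in C) == (v \in C))
                  [:: y; y^-1; z; z^-1] = 1%N.

Definition alternates C y z : Prop :=
  forall i j, (y ^+ 2 ^+ i * z ^+ j \in C) = odd (i + j) (+) (1 \in C).

Lemma card_Cay_nbrs C (S : {set gT}) (s : seq gT) v :
    uniq s -> S =i s ->
  #|[set w in C | Cay S v w]| = count (fun a => v * a \in C) s.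
Proof.
move=> s_uniq Ss; rewrite -size_filter.
have /card_uniqP <- := filter_uniq (fun a => v * a \in C) s_uniq.
rewrite -(card_imset (mem [seq a <- s | v * a \in C]) (mulgI v)).
apply: eq_card => w; rewrite inE; apply/andP/imsetP => [[wC]|[a]].
  rewrite /Cay /= Ss => ws; exists (v^-1 * w); last by rewrite mulKVg.
  by rewrite mem_filter mulKVg wC.
by rewrite mem_filter => /andP[vaC sa] ->; rewrite /Cay /= mulKg Ss.
Qed.

(** Outside C, having three neighbours in C among four means having a single
    mate; so both degree conditions become the same condition, which moreover
    forces C to be nonempty and proper. *)
Lemma regular_set13P C y z :
    uniq [:: y; y^-1; z; z^-1] ->
  regular_set (Cay [set y; y^-1; z; z^-1]) 1 3 C <-> mated C y z.
Proof.
move=> yz_uniq.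
have degE v : #|[set w in C | Cay [set y; y^-1; z; z^-1] v w]|
    = count (fun a => v * a \in C) [:: y; y^-1; z; z^-1].
  by apply: card_Cay_nbrs => // a; rewrite !inE !orbA.
split=> [[_ _ degC degNC] v | matedC].
  have [vC|vNC] := boolP (v \in C).
    by have := degC v vC; rewrite degE /=; do 4!case: (_ \in C).
  by have := degNC v vNC; rewrite degE /=; do 4!case: (_ \in C).
split=> [||v vC|v /negPf vNC].
- by apply/eqP => C0; have := matedC 1; rewrite C0 /= !inE.
- by apply/eqP => C1; have := matedC 1; rewrite C1 /= !inE.
- by have := matedC v; rewrite degE vC /=; do 4!case: (_ \in C).
- by have := matedC v; rewrite degE vNC /=; do 4!case: (_ \in C).
Qed.

Lemma mated_sym C y z : mated C y z -> mated C z y.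
Proof. by move=> Cyz v; have := Cyz v; rewrite /=; lia. Qed.

Definition mate_along C y v :=
  ((v * y \in C) == (v \in C)) || ((v * y^-1 \in C) == (v \in C)).

Lemma mate_alongN C y z v :
  mated C y z -> mate_along C z v = ~~ mate_along C y v.
Proof.
by move=> /(_ v); rewrite /mate_along /=; do 4!case: (_ == _).
Qed.

Lemma mate_along_flip C y z v :
  mated C y z -> mate_along C y v -> (v * z \in C) = ~~ (v \in C).
Proof.
move=> /(_ v); rewrite /mate_along /=.
by do 4!case: (_ \in C); case: (v \in C).
Qed.

(** This is the parity argument on 4-cycles: crossing z changes membership at v
    and at its mate alike. *)
Lemma mate_along_cross C y z v :
    commute y z -> mated C y z -> mate_along C y v ->
  mate_along C y (v * z).
Proof.
move=> cyz Cyz yv; have flip := mate_along_flip Cyz.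
have mateE a : a \in [:: y; y^-1] -> (v * a \in C) = (v \in C) ->
    (v * z * a \in C) = (v * z \in C).
  move=> ya va.
  have caz : a * z = z * a.
    by move: ya; rewrite !inE => /orP[]/eqP->; [| apply/commute_sym/commuteV/commute_sym].
  have y_va : mate_along C y (v * a).
    move: ya va; rewrite !inE /mate_along => /orP[]/eqP-> va.
      by rewrite mulgK va eqxx orbT.
    by rewrite mulgKV va eqxx.
  by rewrite -mulgA -caz mulgA !flip ?va.
case/orP: (yv) => /eqP /mateE; rewrite /mate_along !inE eqxx ?orbT.
  by move=> ->; rewrite ?eqxx.
by move=> ->; rewrite ?eqxx ?orbT.
Qed.

(** A vertex vy with its mate along z would, by the same parity argument,
    propagate that direction back to v. *)
Lemma mate_along_forward C y z v :
    commute y z -> mated C y z -> mate_along C y v ->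
  mate_along C y (v * y).
Proof.
move=> cyz Cyz yv; apply: contraLR yv; rewrite -!(mate_alongN _ Cyz) => zvy.
have Czy' : mated C z y^-1.
  by move=> w; have := Cyz w; rewrite /= invgK; lia.
by rewrite -[v](mulgK y) (mate_along_cross _ Czy') //; apply/commuteV/commute_sym.
Qed.

(** Exactly one of the two steps v, vy, vy^2 joins mates: either v and vy
    are mates and membership changes from vy to vy^2, or vy and vy^2 are mates
    and it changes from v to vy. *)
Lemma mate_along_flip2 C y z v :
    commute y z -> mated C y z -> mate_along C y v ->
  (v * y ^+ 2 \in C) = ~~ (v \in C).
Proof.
move=> cyz Cyz yv; have := mate_along_forward cyz Cyz yv.
have := Cyz (v * y); have := Cyz v; move: yv.
rewrite /mate_along /= mulgK expgS expg1 mulgA.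
by do 8!case: (_ \in C).
Qed.

Lemma mate_along_alternates C y z :
  commute y z -> mated C y z -> mate_along C y 1 -> alternates C y z.
Proof.
move=> cyz Cyz y1.
have y2i i : mate_along C y (y ^+ 2 ^+ i)
    /\ (y ^+ 2 ^+ i \in C) = odd i (+) (1 \in C).
  elim: i => [|i [yi Ci]] //; rewrite expgSr; split.
    by rewrite {2}expgS expg1 mulgA; do 2!apply: (mate_along_forward cyz Cyz).
  by rewrite (mate_along_flip2 cyz Cyz) // Ci addNb.
move=> i j.
suffices [] : mate_along C y (y ^+ 2 ^+ i * z ^+ j)
    /\ (y ^+ 2 ^+ i * z ^+ j \in C) = odd (i + j) (+) (1 \in C) by [].
elim: j => [|j [yj Cj]]; first by rewrite mulg1 addn0; apply: y2i.
rewrite (expgSr z) mulgA (mate_along_flip Cyz) // Cj addnS addNb.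
by split; first apply: (mate_along_cross cyz Cyz).
Qed.

Lemma mated_alternates C y z :
  commute y z -> mated C y z -> alternates C y z \/ alternates C z y.
Proof.
move=> cyz Cyz; have [y1|] := boolP (mate_along C y 1).
  by left; apply: mate_along_alternates.
rewrite -(mate_alongN _ Cyz) => z1; right; apply: mate_along_alternates => //.
exact: mated_sym.
Qed.

End Mates.

Lemma alternates_arith (gT : finGroupType) (C : {set gT}) (x : gT) k l :
    alternates C (x ^+ k) (x ^+ l) ->
  [/\ ~~ odd l, odd l./2 = odd k & 4 %| #[x]].
Proof.
move=> alt.
have parity i j i' j' : k * 2 * i + l * j = k * 2 * i' + l * j' %[mod #[x]] ->
    odd (i + j) = odd (i' + j').
  move=> eq_ij; apply: (@addIb (1 \in C)); rewrite -!alt -!expgM -!expgD.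
  by move/eqP: eq_ij; rewrite -!mulnA -eq_expg_mod_order => /eqP->.
have l_even : ~~ odd l.
  have := parity l 0 0 (k * 2)%N; rewrite !muln0 !addn0 !add0n mulnC.
  by move=> /(_ erefl) ->; lia.
have l2 : (2 * l./2)%N = l by lia.
have n_even : ~~ odd #[x].
  by have := parity 0 #[x] 0 0; rewrite !muln0 !add0n modnMl mod0n => ->.
have n2 : (2 * #[x]./2)%N = #[x] by lia.
split=> //.
  have := parity l./2 0 0 k; rewrite !muln0 !addn0 !add0n -mulnA l2 mulnC.
  exact.
have := parity #[x]./2 0 0 0; rewrite !muln0 !addn0 -mulnA n2.
by rewrite modnMl mod0n => /(_ erefl); lia.
Qed.

Definition quarter_set (gT : finGroupType) (x : gT) : {set gT} :=
  [set x ^+ i | i : 'I_#[x] & i %% 4 < 2].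

Lemma mem_quarter_set (gT : finGroupType) (x : gT) i :
  4 %| #[x] -> (x ^+ i \in quarter_set x) = (i %% 4 < 2).
Proof.
move=> n4; apply/imsetP/idP => [[j] | i4].
  rewrite inE => j4 /eqP; rewrite eq_expg_mod_order => /eqP eq_ij.
  by rewrite -(modn_dvdm i n4) eq_ij modn_dvdm.
exists (Ordinal (ltn_pmod i (order_gt0 x))); last by rewrite /= expg_mod_order.
by rewrite inE /= modn_dvdm.
Qed.

(** Modulo 4, the neighbours of i are i + 1 and i - 1, exactly one of which lies
    on the same side of {0, 1} as i, and i + 2 twice, which lies on the other
    side. *)
Lemma quarter_mated (gT : finGroupType) (x : gT) k l :
    <[x]> = [set: gT] -> 4 %| #[x] -> odd k -> l %% 4 = 2 ->
  mated (quarter_set x) (x ^+ k) (x ^+ l).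
Proof.
move=> x_gen n4 k_odd l4 v.
have /cycleP[i ->] : v \in <[x]> by rewrite x_gen inE.
have memV m : (x ^+ i * x ^- m \in quarter_set x) = ((i + 3 * m) %% 4 < 2).
  rewrite -expVgn invg_expg -expgM -expgD mem_quarter_set //.
  (* The order of x is a multiple of 4, so its predecessor is 3 modulo 4. *)
  have [q nE] : exists q, #[x].-1 = (q * 4 + 3)%N.
    by exists (#[x] %/ 4).-1; have := order_gt0 x; lia.
  by rewrite nE mulnDl -mulnA (mulnC 4) mulnA addnCA modnMDl.
rewrite /= -!expgD !memV !mem_quarter_set //.
lia.
Qed.

Theorem theorem6p1p7 (n k l : nat) (n_gt0 : 0 < n) (k_gt0 : 0 < k)
    (l_gt0 : 0 < l) (gT : finGroupType) (x : gT) (ord_x : #[x]%g = n)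
    (quartic : circulant_quartic x k l)
    (conn : connected_graph (Cay (quartic_set x k l))) :
  [/\ (odd k /\ l = 2 %[mod 4]) \/ (odd l /\ k = 2 %[mod 4]) ->
        (contains_regular_set (Cay (quartic_set x k l)) 1 3 <-> 4 %| n),
      (odd k /\ l = 0 %[mod 4]) \/ (odd l /\ k = 0 %[mod 4]) ->
        ~ contains_regular_set (Cay (quartic_set x k l)) 1 3
    & k = 1 %[mod 2] /\ l = 1 %[mod 2] ->
        ~ contains_regular_set (Cay (quartic_set x k l)) 1 3].
Proof.
have [x_gen /andP[_ kl_uniq]] := quartic.
have regP C := regular_set13P C kl_uniq.
have constraint : contains_regular_set (Cay (quartic_set x k l)) 1 3 ->
    4 %| n /\ (~~ odd l /\ odd l./2 = odd k \/ ~~ odd k /\ odd k./2 = odd l).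
  case=> C /regP Ckl; rewrite -ord_x.
  have ckl : commute (x ^+ k) (x ^+ l) by apply: commuteX2.
  by have [] := mated_alternates ckl Ckl => /alternates_arith[]; auto.
split=> [kl4 | kl4 /constraint | kl2 /constraint]; try lia.
split=> [/constraint[] // | n4]; exists (quarter_set x); apply/regP.
rewrite -ord_x in n4; case: kl4 => -[odd4 two4].
  exact: quarter_mated.
by apply: mated_sym; apply: quarter_mated.
Qed.
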